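(* Let $(V,\circ,[\cdot,\cdot])$ be a Gel'fand-Dorfman bialgebra over $\mathbb{C}$ whose Novikov product $\circ$ is not identically zero, and let $R=\mathbb{C}[\partial]V$ be the corresponding quadratic Lie conformal algebra. If $R$ is simple, then $(V,\circ,[\cdot,\cdot])$ has no proper Gel'fand-Dorfman ideals.
   Context: All vector spaces are over $\mathbb{C}$. A Lie conformal algebra is a $\mathbb{C}[\partial]$-module $R$ with a $\mathbb{C}$-bilinear $\lambda$-bracket $[\cdot_\lambda\cdot]:R\times R\to R[\lambda]=R\otimes\mathbb{C}[\lambda]$ such that for all $a,b,c\in R$: $[\partial a_\lambda b]=-\lambda[a_\lambda b]$ and $[a_\lambda\partial b]=(\lambda+\partial)[a_\lambda b]$; $[a_\lambda b]=-[b_{-\lambda-\partial}a]$; $[a_\lambda[b_\mu c]]=[[a_\lambda b]_{\lambda+\mu}c]+[b_\mu[a_\lambda c]]$. For subspaces $A,B\subset R$, $[A,B]$ is the $\mathbb{C}$-linear span of all coefficients (in powers of $\lambda$) of $[a_\lambda b]$, $a\in A$, $b\in B$. An ideal of $R$ is a $\mathbb{C}[\partial]$-submodule $I\subset R$ with $[R,I]\subset I$. $R$ is abelian if $[R,R]=0$, and simple if it is not abelian and its only ideals are $0$ and $R$. A Novikov algebra is a vector space $V$ with a bilinear product $\circ$ satisfying $(a\circ b)\circ c-a\circ(b\circ c)=(b\circ a)\circ c-b\circ(a\circ c)$ and $(a\circ b)\circ c=(a\circ c)\circ b$. An ideal of $(V,\circ)$ is a subspace $I$ with $V\circ I\subset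 I$ and $I\circ V\subset I$. A Gel'fand-Dorfman bialgebra $(V,\circ,[\cdot,\cdot])$ is a vector space $V$ with a Lie bracket $[\cdot,\cdot]$ and a product $\circ$ such that $(V,\circ)$ is a Novikov algebra and $[a\circ b,c]-[a\circ c,b]+[a,b]\circ c-[a,c]\circ b-a\circ[b,c]=0$ for all $a,b,c\in V$. A Gel'fand-Dorfman ideal is a subspace $I\subset V$ that is an ideal of the Lie algebra $(V,[\cdot,\cdot])$ and an ideal of the Novikov algebra $(V,\circ)$; it is proper if it is neither $0$ nor $V$. The quadratic Lie conformal algebra corresponding to $(V,\circ,[\cdot,\cdot])$ is the free $\mathbb{C}[\partial]$-module $R=\mathbb{C}[\partial]V=\mathbb{C}[\partial]\otimes V$ with the $\lambda$-bracket determined by $[a_\lambda b]=\partial(b\circ a)+[b,a]+\lambda(a\circ b+b\circ a)$ for $a,b\in V$. *)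

(* Defs.v *)
From HB Require Import structures.
From mathcomp Require Import all_boot all_order all_algebra.
From mathcomp Require Import finmap monalg ring classical_sets.

Set Implicit Arguments.
Unset Strict Implicit.
Unset Printing Implicit Defensive.

Import GRing.Theory.
Local Open Scope fset_scope.
Local Open Scope ring_scope.

(* For a module M over a commutative ring A, [vpoly M] is M[x], i.e. the      *)
(* module M (x)_A A[x] over A[x], encoded as finitely supported sequences of  *)
(* coefficients; [u@_k] is the coefficient of x^k in u.                       *)
Section ModulePolynomials.
Variables (A : comNzRingType) (M : lmodType A).

Implicit Types (p q : {poly A}) (u v : {malg M[nat]}).

Definition vscale p u : {malg M[nat]} :=
  \sum_(i < size p) \sum_(k <- msupp u) << p`_i *: u@_k *g (i + k)%N >>.

Lemma vscaleEw n (d : {fset nat}) p u : (size p <= n)%N -> msupp u `<=` d ->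
  vscale p u = \sum_(i < n) \sum_(k <- d) << p`_i *: u@_k *g (i + k)%N >>.
Proof.
move=> le_pn le_ud; rewrite /vscale.
rewrite (big_ord_widen n
  (fun i => \sum_(k <- msupp u) << p`_i *: u@_k *g (i + k)%N >>) le_pn).
rewrite big_mkcond /=; apply: eq_bigr => i _.
case: ltnP => [_ | le_pi].
  apply: big_fset_incl => // k _ /mcoeff_outdom ->.
  by rewrite scaler0 monalgU0.
by rewrite nth_default // big1 // => k _; rewrite scale0r monalgU0.
Qed.

Lemma vscaleDr p u v : vscale p (u + v) = vscale p u + vscale p v.
Proof.
pose d := msupp u `|` msupp v.
rewrite !(@vscaleEw (size p) d) ?fsubsetUl ?fsubsetUr ?msuppD_le //.
rewrite -big_split; apply: eq_bigr => i _; rewrite -big_split.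
by apply: eq_bigr => k _; rewrite /= mcoeffD scalerDr monalgUD.
Qed.

Lemma vscaleDl u p q : vscale (p + q) u = vscale p u + vscale q u.
Proof.
pose n := maxn (size p) (size q).
rewrite !(@vscaleEw n (msupp u)) ?leq_maxl ?leq_maxr ?size_polyD //.
rewrite -big_split; apply: eq_bigr => i _; rewrite -big_split.
by apply: eq_bigr => k _; rewrite /= coefD scalerDl monalgUD.
Qed.

Lemma vscale0r u : vscale 0 u = 0.
Proof. by rewrite /vscale size_poly0 big_ord0. Qed.

Lemma vscaler0 p : vscale p 0 = 0.
Proof. by rewrite /vscale big1 // => i _; rewrite msupp0 big_nil. Qed.

Lemma vscale_sumr (I : Type) (r : seq I) (F : I -> {malg M[nat]}) p :
  vscale p (\sum_(i <- r) F i) = \sum_(i <- r) vscale p (F i).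
Proof. exact: (big_morph _ (vscaleDr p) (vscaler0 p)). Qed.

Lemma vscale_suml (I : Type) (r : seq I) (F : I -> {poly A}) u :
  vscale (\sum_(i <- r) F i) u = \sum_(i <- r) vscale (F i) u.
Proof. exact: (big_morph _ (vscaleDl u) (vscale0r u)). Qed.

Lemma vscale_mon (c : A) i (x : M) k :
  vscale (c *: 'X^i) << x *g k >> = << c *: x *g (i + k)%N >>.
Proof.
rewrite (@vscaleEw i.+1 [fset k]%fset) ?msuppU_le //; last first.
  by rewrite (leq_trans (size_scale_leq _ _)) // size_polyXn.
rewrite big_ord_recr /= big1 ?add0r; last first.
  move=> j _; rewrite big_seq_fset1 coefZ coefXn ltn_eqF //.
  by rewrite mulr0 scale0r monalgU0.
by rewrite big_seq_fset1 coefZ coefXn eqxx mulr1 mcoeffUU.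
Qed.

Lemma vscaleA p q u : vscale p (vscale q u) = vscale (p * q) u.
Proof.
rewrite [u]monalgE -(coefK p) -(coefK q) !poly_def.
rewrite mulr_suml !vscale_suml; apply: eq_bigr => i _.
rewrite mulr_sumr !vscale_suml vscale_sumr; apply: eq_bigr => j _.
rewrite !vscale_sumr; apply: eq_bigr => k _.
by rewrite -scalerAl -scalerAr scalerA -exprD !vscale_mon scalerA addnA.
Qed.

Lemma vscale1r u : vscale 1 u = u.
Proof.
rewrite [u in LHS]monalgE vscale_sumr [RHS]monalgE; apply: eq_bigr => k _.
by rewrite -(expr0 'X) -['X^0]scale1r vscale_mon scale1r.
Qed.

Definition vpoly : Type := {malg M[nat]}.
HB.instance Definition _ := GRing.Zmodule.on vpoly.
HB.instance Definition _ := GRing.Zmodule_isLmodule.Build {poly A} vpoly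
  vscaleA vscale1r vscaleDr vscaleDl.

Definition vconst (x : M) : vpoly := << x *g 0%N >>.

Lemma vscaleXn_mon i (x : M) k :
  ('X^i : {poly A}) *: (<< x *g k >> : vpoly) = << x *g (i + k)%N >>.
Proof. by rewrite -[LHS]/(vscale _ _) -['X^i]scale1r vscale_mon scale1r. Qed.

Lemma vscaleC (c : A) (x : M) : c%:P *: vconst x = vconst (c *: x).
Proof.
by rewrite -[LHS]/(vscale _ _) -[c%:P]mulr1 mul_polyC -(expr0 'X) vscale_mon.
Qed.

Lemma vconstD (x y : M) : vconst (x + y) = vconst x + vconst y.
Proof. exact: monalgUD. Qed.

Lemma vconstN (x : M) : vconst (- x) = - vconst x.
Proof. exact: monalgUN. Qed.

Lemma vpoly_ind (P : vpoly -> Prop) :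
    (forall u v : vpoly, P u -> P v -> P (u + v)) ->
    (forall u : vpoly, P u -> P ('X *: u)) -> (forall x, P (vconst x)) ->
  forall u : vpoly, P u.
Proof.
move=> PD PX PC u; have P0 : P 0 by rewrite -(monalgU0 0%N); apply: PC.
rewrite [u]monalgE; elim/big_ind: _ => [//|//|k _].
rewrite -[k]addn0 -vscaleXn_mon addn0.
elim: k (u@_k) => [|k IHk] x; first by rewrite expr0 scale1r; apply: PC.
by rewrite exprS -scalerA; apply/PX/IHk.
Qed.

End ModulePolynomials.

(* Substitution of q for x in u : M[x], the coefficients being transported to *)
(* the B-module N by f.                                                       *)
Definition vsubst (A B : comNzRingType) (M : lmodType A) (N : lmodType B)
    (f : M -> N) (q : B) (u : vpoly M) : N :=
  \sum_(k <- msupp u) q ^+ k *: f u@_k.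

Section SubstTheory.
Variables (A B : comNzRingType) (M : lmodType A) (N : lmodType B).
Variables (f : M -> N) (q : B) (fD : {morph f : x y / x + y}).

Let f0 : f 0 = 0.
Proof. by apply: (addrI (f 0)); rewrite -fD !addr0. Qed.

Lemma vsubstEw (d : {fset nat}) (u : vpoly M) : msupp u `<=` d ->
  vsubst f q u = \sum_(k <- d) q ^+ k *: f u@_k.
Proof.
move=> le_ud; apply: big_fset_incl => // k _ /mcoeff_outdom ->.
by rewrite f0 scaler0.
Qed.

Lemma vsubstD : {morph vsubst f q : u v / u + v}.
Proof.
move=> u v; pose d := msupp u `|` msupp v.
rewrite !(@vsubstEw d) ?fsubsetUl ?fsubsetUr ?msuppD_le // -big_split.
by apply: eq_bigr => k _; rewrite /= mcoeffD fD scalerDr.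
Qed.

Lemma vsubst_mon k x : vsubst f q (<< x *g k >> : vpoly M) = q ^+ k *: f x.
Proof.
by rewrite (@vsubstEw [fset k]) ?msuppU_le // big_seq_fset1 mcoeffUU.
Qed.

Lemma vsubst_const x : vsubst f q (vconst x) = f x.
Proof. by rewrite vsubst_mon expr0 scale1r. Qed.

Lemma vsubstX u : vsubst f q ('X *: u) = q *: vsubst f q u.
Proof.
have vsubst0 : vsubst f q 0 = 0 by rewrite /vsubst msupp0 big_nil.
rewrite [u]monalgE scaler_sumr !(big_morph _ vsubstD vsubst0) scaler_sumr.
apply: eq_bigr => k _.
by rewrite -['X]expr1 vscaleXn_mon !vsubst_mon scalerA -exprS.
Qed.

Lemma vsubstC c r : (forall x, f (c *: x) = r *: f x) ->
  forall u, vsubst f q (c%:P *: u) = r *: vsubst f q u.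
Proof.
move=> fZ; elim/vpoly_ind => [u v IHu IHv|u IHu|x].
- by rewrite scalerDr !vsubstD IHu IHv scalerDr.
- by rewrite scalerA mulrC -scalerA !vsubstX IHu !scalerA mulrC.
- by rewrite vscaleC !vsubst_const.
Qed.

Lemma vsubstN u : vsubst f q (- u) = - vsubst f q u.
Proof.
apply: (addrI (vsubst f q u)); rewrite -vsubstD !subrr.
by apply: (addrI (vsubst f q 0)); rewrite -vsubstD !addr0.
Qed.

Lemma vsubstNX u : vsubst f q (- 'X *: u) = - q *: vsubst f q u.
Proof. by rewrite !scaleNr vsubstN vsubstX. Qed.

Lemma vsubstXC c r : (forall x, f (c *: x) = r *: f x) ->
  forall u, vsubst f q (('X + c%:P) *: u) = (q + r) *: vsubst f q u.
Proof. by move=> fZ u; rewrite !scalerDl vsubstD vsubstX (vsubstC fZ). Qed.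

End SubstTheory.

Section SubstFunTheory.
Variables (A B : comNzRingType) (M : lmodType A) (N : lmodType B).
Implicit Types (f g h : M -> N) (q r : B) (u : vpoly M).

Lemma vsubstDf f g h q u : (forall x, h x = f x + g x) ->
  vsubst h q u = vsubst f q u + vsubst g q u.
Proof.
move=> hE; rewrite /vsubst -big_split; apply: eq_bigr => k _.
by rewrite hE scalerDr.
Qed.

Lemma vsubstZf f h q r u : (forall x, h x = r *: f x) ->
  vsubst h q u = r *: vsubst f q u.
Proof.
move=> hE; rewrite /vsubst scaler_sumr; apply: eq_bigr => k _.
by rewrite hE !scalerA mulrC.
Qed.

End SubstFunTheory.

(* Reflexive normalization of linear combinations in a module. *)
Section LinearExpressions.
Variables (S : comNzRingType) (N : lmodType S).

Inductive linexp :=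
  LinAtom of nat | LinScale of S & linexp | LinAdd of linexp & linexp
| LinOpp of linexp.

Fixpoint lin_eval (env : seq N) (e : linexp) : N :=
  match e with
  | LinAtom i => env`_i
  | LinScale s e => s *: lin_eval env e
  | LinAdd e1 e2 => lin_eval env e1 + lin_eval env e2
  | LinOpp e => - lin_eval env e
  end.

Fixpoint lin_coef (e : linexp) (i : nat) : S :=
  match e with
  | LinAtom j => if j == i then 1 else 0
  | LinScale s e => s * lin_coef e i
  | LinAdd e1 e2 => lin_coef e1 i + lin_coef e2 i
  | LinOpp e => - lin_coef e i
  end.

Lemma lin_evalE env e :
  lin_eval env e = \sum_(i < size env) lin_coef e i *: env`_i.
Proof.
elim: e => [j|s e IHe|e1 IH1 e2 IH2|e IHe] /=.
- have [lt_j|le_j] := ltnP j (size env).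
    rewrite (bigD1 (Ordinal lt_j)) //= eqxx scale1r big1 ?addr0 // => i.
    by rewrite -val_eqE /= eq_sym => /negPf->; rewrite scale0r.
  rewrite nth_default // big1 // => i _.
  by rewrite gtn_eqF ?scale0r // (leq_trans (ltn_ord i)).
- by rewrite IHe scaler_sumr; apply: eq_bigr => i _; rewrite scalerA.
- by rewrite IH1 IH2 -big_split; apply: eq_bigr => i _; rewrite scalerDl.
- by rewrite IHe -sumrN; apply: eq_bigr => i _; rewrite scaleNr.
Qed.

Lemma lin_eq env e1 e2 :
    foldr (fun i P => lin_coef e1 i = lin_coef e2 i /\ P) True
      (iota 0 (size env)) ->
  lin_eval env e1 = lin_eval env e2.
Proof.
move=> eq12; rewrite !lin_evalE; apply: eq_bigr => i _; congr (_ *: _).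
have: (i : nat) \in iota 0 (size env) by rewrite mem_iota ltn_ord.
elim: (iota _ _) eq12 => //= j s IHs [eqj eqs].
by rewrite inE => /predU1P[->|/(IHs eqs)].
Qed.

End LinearExpressions.

Ltac lin_index x env :=
  lazymatch env with
  | x :: _ => constr:(0%N)
  | _ :: ?env' => let n := lin_index x env' in constr:(S n)
  end.

Ltac lin_add x env :=
  lazymatch env with
  | context [x] => env
  | _ => constr:(x :: env)
  end.

Ltac lin_atoms t env :=
  lazymatch t with
  | ?a + ?b => let env' := lin_atoms a env in lin_atoms b env'
  | - ?a => lin_atoms a env
  | _ *: ?a => lin_atoms a env
  | _ => lin_add t env
  end.

Ltac lin_reify S t env :=
  lazymatch t with
  | ?a + ?b => let ea := lin_reify S a env in let eb := lin_reify S b env in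
               constr:(@LinAdd S ea eb)
  | - ?a => let ea := lin_reify S a env in constr:(@LinOpp S ea)
  | ?s *: ?a => let ea := lin_reify S a env in constr:(@LinScale S s ea)
  | _ => let i := lin_index t env in constr:(@LinAtom S i)
  end.

Ltac lin_ring S N :=
  lazymatch goal with
  | |- ?a = ?b =>
    let env0 := lin_atoms a (@nil N) in
    let env := lin_atoms b env0 in
    let ea := lin_reify S a env in
    let eb := lin_reify S b env in
    apply: (@lin_eq S _ env ea eb); rewrite /=; repeat split; ring
  end.

(* The lambda-bracket takes its values in R[lambda] = [vpoly R], which is a   *)
(* module over {poly {poly K}}: there 'X is lambda and 'X%:P is partial.  In  *)
(* R[lambda, mu] = [vpoly (vpoly R)], a module over {poly {poly {poly K}}},   *)
(* 'X is mu, 'X%:P is lambda and 'X%:P%:P is partial.                         *)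
Record lieConformalAlgebra (K : fieldType) := LieConformalAlgebra {
  lca_sort :> lmodType {poly K};
  lca_bracket : lca_sort -> lca_sort -> vpoly lca_sort;
  lca_bracketDl : forall a b c,
    lca_bracket (a + b) c = lca_bracket a c + lca_bracket b c;
  lca_bracketDr : forall a b c,
    lca_bracket a (b + c) = lca_bracket a b + lca_bracket a c;
  lca_bracketZl : forall (k : K) a b,
    lca_bracket (k%:P *: a) b = k%:P%:P *: lca_bracket a b;
  lca_bracketZr : forall (k : K) a b,
    lca_bracket a (k%:P *: b) = k%:P%:P *: lca_bracket a b;
  lca_sesquil : forall a b,
    lca_bracket ('X *: a) b = - 'X *: lca_bracket a b;
  lca_sesquir : forall a b,
    lca_bracket a ('X *: b) = ('X + 'X%:P) *: lca_bracket a b;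
  lca_skew : forall a b,
    lca_bracket a b = - vsubst (@vconst _ _) (- 'X - 'X%:P) (lca_bracket b a);
  lca_jacobi : forall a b c,
    let lam : {poly {poly {poly K}}} := 'X%:P in
    let mu : {poly {poly {poly K}}} := 'X in
    let inj (r : lca_sort) : vpoly (vpoly lca_sort) := vconst (vconst r) in
    vsubst (fun r => vconst (lca_bracket a r)) mu (lca_bracket b c)
    = vsubst (fun r => vsubst inj (lam + mu) (lca_bracket r c)) lam
        (lca_bracket a b)
      + vsubst (fun r => vsubst inj mu (lca_bracket b r)) lam
          (lca_bracket a c)
}.

Section LieConformalIdeals.
Variables (K : fieldType) (R : lieConformalAlgebra K).
Local Open Scope classical_set_scope.

Definition lca_commutator (A B : set R) : set R :=
  [set x | exists (n : nat) (k : 'I_n -> K) (y : 'I_n -> R),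
     (forall i, exists a b j,
        [/\ A a, B b & y i = (lca_bracket a b)@_j])
     /\ x = \sum_(i < n) (k i)%:P *: y i].

Definition lca_ideal (I : set R) : Prop :=
  submod_closed (mem I) /\ lca_commutator setT I `<=` I.

Definition lca_abelian : Prop := lca_commutator setT setT = [set 0].

Definition lca_simple : Prop :=
  ~ lca_abelian /\ forall I : set R, lca_ideal I -> I = [set 0] \/ I = setT.

End LieConformalIdeals.

Record gelfandDorfman (K : fieldType) := GelfandDorfman {
  gd_sort :> lmodType K;
  gd_mul : {bilinear gd_sort -> gd_sort -> gd_sort};
  gd_lie : {bilinear gd_sort -> gd_sort -> gd_sort};
  gd_lie_alt : forall a, gd_lie a a = 0;
  gd_lie_jacobi : forall a b c,
    gd_lie a (gd_lie b c) + gd_lie b (gd_lie c a) + gd_lie c (gd_lie a b) = 0;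
  gd_mul_lsym : forall a b c,
    gd_mul (gd_mul a b) c - gd_mul a (gd_mul b c)
    = gd_mul (gd_mul b a) c - gd_mul b (gd_mul a c);
  gd_mul_rcomm : forall a b c,
    gd_mul (gd_mul a b) c = gd_mul (gd_mul a c) b;
  gd_compat : forall a b c,
    gd_lie (gd_mul a b) c - gd_lie (gd_mul a c) b + gd_mul (gd_lie a b) c
    - gd_mul (gd_lie a c) b - gd_mul a (gd_lie b c) = 0
}.

Arguments gd_mul {K g}.
Arguments gd_lie {K g}.

Definition gd_ideal (K : fieldType) (V : gelfandDorfman K) (I : set V) : Prop :=
  [/\ submod_closed (mem I),
      forall x y : V, I y -> I (gd_lie x y) &
      forall x y : V, I y -> I (gd_mul x y) /\ I (gd_mul y x)].

Definition gd_proper_ideal (K : fieldType) (V : gelfandDorfman K) (I : set V) :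
    Prop :=
  [/\ gd_ideal I, I <> [set 0]%classic & I <> setT].

Section Quadratic.
Variables (K : fieldType) (V : gelfandDorfman K).

(* [a_lambda b] for a, b in V; the inner [vconst] embeds V into K[partial]V,  *)
(* the outer one embeds K[partial]V into K[partial]V[lambda].                 *)
Definition quad_gen (a b : V) : vpoly (vpoly V) :=
  vconst ('X *: vconst (gd_mul b a) + vconst (gd_lie b a))
  + 'X *: vconst (vconst (gd_mul a b + gd_mul b a)).

(* The extension to K[partial]V forced by sesquilinearity, which reads        *)
(* [p(partial)a_lambda q(partial)b] =                                         *)
(*   p(-lambda) q(lambda + partial) [a_lambda b].                             *)
Definition quad_bracket (u v : vpoly V) : vpoly (vpoly V) :=
  vsubst (fun a => vsubst (quad_gen a) ('X + 'X%:P) v) (- 'X) u.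

Local Notation "a ** b" := (gd_mul a b) (at level 40).
Local Notation "[' a , b ]" := (gd_lie a b).

Definition quad_emb (x : V) : vpoly (vpoly V) := vconst (vconst x).

Lemma quad_embD x y : quad_emb (x + y) = quad_emb x + quad_emb y.
Proof. by rewrite /quad_emb !vconstD. Qed.

Lemma quad_embN x : quad_emb (- x) = - quad_emb x.
Proof. by rewrite /quad_emb !vconstN. Qed.

Lemma quad_embZ (k : K) x : quad_emb (k *: x) = k%:P%:P *: quad_emb x.
Proof. by rewrite /quad_emb !vscaleC. Qed.

Lemma quad_genE a b : quad_gen a b =
  'X%:P *: quad_emb (b ** a) + quad_emb [' b, a]
  + 'X *: (quad_emb (a ** b) + quad_emb (b ** a)).
Proof. by rewrite /quad_gen !vconstD vscaleC. Qed.

Lemma quad_genDl b : {morph (fun a => quad_gen a b) : a a' / a + a'}.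
Proof.
move=> a a'; rewrite !quad_genE !(linearDl, linearDr) /= !quad_embD.
lin_ring {poly {poly K}} (vpoly (vpoly V)).
Qed.

Lemma quad_genDr a : {morph quad_gen a : b b' / b + b'}.
Proof.
move=> b b'; rewrite !quad_genE !(linearDl, linearDr) /= !quad_embD.
lin_ring {poly {poly K}} (vpoly (vpoly V)).
Qed.

Lemma quad_genZl (k : K) a b :
  quad_gen (k *: a) b = k%:P%:P *: quad_gen a b.
Proof.
rewrite !quad_genE !(linearZl_LR, linearZr_LR) /= !quad_embZ.
lin_ring {poly {poly K}} (vpoly (vpoly V)).
Qed.

Lemma quad_genZr (k : K) a b :
  quad_gen a (k *: b) = k%:P%:P *: quad_gen a b.
Proof.
rewrite !quad_genE !(linearZl_LR, linearZr_LR) /= !quad_embZ.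
lin_ring {poly {poly K}} (vpoly (vpoly V)).
Qed.

Let extDl v : {morph (fun a => vsubst (quad_gen a) ('X + 'X%:P) v)
  : a a' / a + a'}.
Proof. by move=> a a'; apply: vsubstDf => b; apply: quad_genDl. Qed.

Lemma quad_bracketDl u v w :
  quad_bracket (u + v) w = quad_bracket u w + quad_bracket v w.
Proof. exact: vsubstD. Qed.

Lemma quad_bracketDr u v w :
  quad_bracket u (v + w) = quad_bracket u v + quad_bracket u w.
Proof. by apply: vsubstDf => a; apply/vsubstD/quad_genDr. Qed.

Lemma quad_sesquil u v :
  quad_bracket ('X *: u) v = - 'X *: quad_bracket u v.
Proof. exact: vsubstX. Qed.

Lemma quad_sesquir u v :
  quad_bracket u ('X *: v) = ('X + 'X%:P) *: quad_bracket u v.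
Proof. by apply: vsubstZf => a; apply/vsubstX/quad_genDr. Qed.

Lemma quad_bracketZl (k : K) u v :
  quad_bracket (k%:P *: u) v = k%:P%:P *: quad_bracket u v.
Proof.
apply: vsubstC => // a; apply: vsubstZf => b; exact: quad_genZl.
Qed.

Lemma quad_bracketZr (k : K) u v :
  quad_bracket u (k%:P *: v) = k%:P%:P *: quad_bracket u v.
Proof.
apply: vsubstZf => a; apply: vsubstC => [|b]; first exact: quad_genDr.
exact: quad_genZr.
Qed.

Lemma quad_bracket_const a b :
  quad_bracket (vconst a) (vconst b) = quad_gen a b.
Proof.
by rewrite /quad_bracket vsubst_const // vsubst_const //; apply: quad_genDr.
Qed.

Lemma gd_lieC (a b : V) : [' a, b] = - [' b, a].
Proof.
apply/eqP; rewrite -addr_eq0; apply/eqP.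
have := gd_lie_alt (a + b).
by rewrite linearDl !linearDr /= !gd_lie_alt add0r addr0.
Qed.

Lemma quad_jacobi_gen (S : comNzRingType) (N : lmodType S) (f : V -> N)
    (fD : {morph f : x y / x + y}) (fN : {morph f : x / - x})
    (del lam mu : S) (a b c : V) :
  let B q x y := del *: f (y ** x) + f [' y, x] + q *: (f (x ** y) + f (y ** x))
  in
  (lam + del) *: B lam a (c ** b) + B lam a [' c, b]
    + mu *: B lam a (b ** c + c ** b)
  = - (lam + mu) *: B (lam + mu) (b ** a) c + B (lam + mu) [' b, a] c
      + lam *: B (lam + mu) (a ** b + b ** a) c
    + ((mu + del) *: B mu b (c ** a) + B mu b [' c, a]
      + lam *: B mu b (a ** c + c ** a)).
Proof.
move=> B; rewrite {}/B.
rewrite !(linearDl, linearDr) /= (gd_lieC c b) (gd_lieC b a) (gd_lieC c a).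
rewrite !(linearNl, linearNr) /=.
rewrite (gd_lieC c (a ** b)) (gd_lieC c (b ** a)) (gd_lieC c [' a, b]).
have compat (x y z : V) : x ** [' y, z] =
    [' x ** y, z] - [' x ** z, y] + [' x, y] ** z - [' x, z] ** y.
  by apply/esym/eqP; rewrite -subr_eq0 gd_compat.
have lsym (x y z : V) : x ** (y ** z) =
    (x ** y) ** z - (y ** x) ** z + y ** (x ** z).
  rewrite -{1}[x ** (y ** z)](subKr ((x ** y) ** z)) (gd_mul_lsym x y z).
  lin_ring K V.
have jac : [' [' b, c], a] = [' [' a, c], b] - [' [' a, b], c].
  rewrite (gd_lieC [' b, c] a) (gd_lieC [' a, c] b) (gd_lieC a c).
  rewrite (gd_lieC [' a, b] c) linearNr /= !opprK; apply/esym/eqP.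
  by rewrite -subr_eq0 opprK addrC addrA gd_lie_jacobi.
rewrite (compat a b c) (compat b a c) (compat c a b).
rewrite (lsym a b c) (lsym b c a) (lsym a c b).
rewrite !(gd_mul_rcomm a c b) !(gd_mul_rcomm b c a) !(gd_mul_rcomm c b a).
rewrite jac (gd_lieC b a) (gd_lieC c a) (gd_lieC c b).
rewrite !(linearNl, linearNr) /= !(fD, fN).
lin_ring S N.
Qed.

Let skew_rhs (u : vpoly (vpoly V)) : vpoly (vpoly V) :=
  - vsubst (@vconst _ _) (- 'X - 'X%:P) u.

Let skewD u v : skew_rhs (u + v) = skew_rhs u + skew_rhs v.
Proof. by rewrite /skew_rhs vsubstD ?opprD //; apply: vconstD. Qed.

Let skewN u : skew_rhs (- u) = - skew_rhs u.
Proof. by rewrite /skew_rhs vsubstN //; apply: vconstD. Qed.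

Let skewX u : skew_rhs ('X *: u) = (- 'X - 'X%:P) *: skew_rhs u.
Proof. by rewrite /skew_rhs vsubstX ?scalerN //; apply: vconstD. Qed.

Let skewP p u : skew_rhs (p%:P *: u) = p%:P *: skew_rhs u.
Proof.
rewrite /skew_rhs (@vsubstC _ _ _ _ _ _ _ _ p%:P) ?scalerN // => [x y|x].
  exact: vconstD.
by rewrite vscaleC.
Qed.

Let skew_const x : skew_rhs (quad_emb x) = - quad_emb x.
Proof. by rewrite /skew_rhs vsubst_const //; apply: vconstD. Qed.

Lemma quad_skew u v : quad_bracket u v =
  - vsubst (@vconst _ _) (- 'X - 'X%:P) (quad_bracket v u).
Proof.
rewrite -/(skew_rhs _).
elim/vpoly_ind: u v => [u u' IH IH'|u IH|a] v.
- rewrite (quad_bracketDl u u') (quad_bracketDr v u) skewD.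
  by congr (_ + _); [apply: IH | apply: IH'].
- rewrite (quad_sesquil u) (quad_sesquir v u) scalerDl skewD skewX skewP -IH.
  lin_ring {poly {poly K}} (vpoly (vpoly V)).
elim/vpoly_ind: v => [v v' IH IH'|v IH|b].
- rewrite (quad_bracketDl v v') (quad_bracketDr _ v) skewD.
  by congr (_ + _); [apply: IH | apply: IH'].
- rewrite (quad_sesquil v) (quad_sesquir _ v) scaleNr.
  rewrite skewN skewX -IH.
  lin_ring {poly {poly K}} (vpoly (vpoly V)).
rewrite !quad_bracket_const !quad_genE !skewD skewP skewX !skewD !skew_const.
rewrite (gd_lieC b a) !quad_embN.
lin_ring {poly {poly K}} (vpoly (vpoly V)).
Qed.


Let S3 : comNzRingType := {poly {poly {poly K}}}.
Let N3 : lmodType S3 := vpoly (vpoly (vpoly V)).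
Let lam : S3 := ('X%:P : {poly {poly {poly K}}}).
Let mu : S3 := ('X : {poly {poly {poly K}}}).
Let del : S3 := ('X%:P%:P : {poly {poly {poly K}}}).
Let inj (r : vpoly V) : N3 := vconst (vconst r).

Let injD r s : inj (r + s) = inj r + inj s.
Proof. by rewrite /inj !vconstD. Qed.

Let injX r : inj ('X *: r) = del *: inj r.
Proof. by rewrite /inj !vscaleC. Qed.

Let F u r : N3 := vconst (quad_bracket u r).
Let G w r := @vsubst _ S3 _ N3 inj (lam + mu) (quad_bracket r w).
Let H v r := @vsubst _ S3 _ N3 inj mu (quad_bracket v r).

Let FDl u u' r : F (u + u') r = F u r + F u' r.
Proof. by rewrite /F quad_bracketDl vconstD. Qed.

Let FDr u r r' : F u (r + r') = F u r + F u r'.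
Proof. by rewrite /F quad_bracketDr vconstD. Qed.

Let FXl u r : F ('X *: u) r = - lam *: F u r.
Proof. by rewrite /F quad_sesquil -vscaleC rmorphN. Qed.

Let FXr u r : F u ('X *: r) = (lam + del) *: F u r.
Proof. by rewrite /F quad_sesquir -vscaleC rmorphD. Qed.

Let GDl w w' r : G (w + w') r = G w r + G w' r.
Proof. by rewrite /G quad_bracketDr vsubstD. Qed.

Let GDr w r r' : G w (r + r') = G w r + G w r'.
Proof. by rewrite /G quad_bracketDl vsubstD. Qed.

Let GXl w r : G ('X *: w) r = (lam + mu + del) *: G w r.
Proof. by rewrite /G quad_sesquir (vsubstXC _ _ injX). Qed.

Let GXr w r : G w ('X *: r) = - (lam + mu) *: G w r.
Proof. by rewrite /G quad_sesquil vsubstNX. Qed.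

Let HDl v v' r : H (v + v') r = H v r + H v' r.
Proof. by rewrite /H quad_bracketDl vsubstD. Qed.

Let HDr v r r' : H v (r + r') = H v r + H v r'.
Proof. by rewrite /H quad_bracketDr vsubstD. Qed.

Let HXl v r : H ('X *: v) r = - mu *: H v r.
Proof. by rewrite /H quad_sesquil vsubstNX. Qed.

Let HXr v r : H v ('X *: r) = (mu + del) *: H v r.
Proof. by rewrite /H quad_sesquir (vsubstXC _ _ injX). Qed.

(* The three terms of the Jacobi identity are additive and sesquilinear in u, *)
(* v, w with the same weights, so the identity J reduces to generators.       *)
Let T1 u v w := @vsubst _ S3 _ N3 (F u) mu (quad_bracket v w).
Let T2 u v w := @vsubst _ S3 _ N3 (G w) lam (quad_bracket u v).
Let T3 u v w := @vsubst _ S3 _ N3 (H v) lam (quad_bracket u w).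

Let J u v w := T1 u v w = T2 u v w + T3 u v w.

Let T1D1 u u' v w : T1 (u + u') v w = T1 u v w + T1 u' v w.
Proof. by apply: vsubstDf => r; apply: FDl. Qed.
Let T1D2 u v v' w : T1 u (v + v') w = T1 u v w + T1 u v' w.
Proof. by rewrite /T1 quad_bracketDl (vsubstD _ (FDr u)). Qed.
Let T1D3 u v w w' : T1 u v (w + w') = T1 u v w + T1 u v w'.
Proof. by rewrite /T1 quad_bracketDr (vsubstD _ (FDr u)). Qed.

Let T2D1 u u' v w : T2 (u + u') v w = T2 u v w + T2 u' v w.
Proof. by rewrite /T2 quad_bracketDl (vsubstD _ (GDr w)). Qed.
Let T2D2 u v v' w : T2 u (v + v') w = T2 u v w + T2 u v' w.
Proof. by rewrite /T2 quad_bracketDr (vsubstD _ (GDr w)). Qed.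
Let T2D3 u v w w' : T2 u v (w + w') = T2 u v w + T2 u v w'.
Proof. by apply: vsubstDf => r; apply: GDl. Qed.

Let T3D1 u u' v w : T3 (u + u') v w = T3 u v w + T3 u' v w.
Proof. by rewrite /T3 quad_bracketDl (vsubstD _ (HDr v)). Qed.
Let T3D2 u v v' w : T3 u (v + v') w = T3 u v w + T3 u v' w.
Proof. by apply: vsubstDf => r; apply: HDl. Qed.
Let T3D3 u v w w' : T3 u v (w + w') = T3 u v w + T3 u v w'.
Proof. by rewrite /T3 quad_bracketDr (vsubstD _ (HDr v)). Qed.

Let T1X1 u v w : T1 ('X *: u) v w = - lam *: T1 u v w.
Proof. by apply: vsubstZf => r; apply: FXl. Qed.
Let T1X2 u v w : T1 u ('X *: v) w = - mu *: T1 u v w.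
Proof. by rewrite /T1 quad_sesquil (vsubstNX _ (FDr u)). Qed.
Let T1X3 u v w : T1 u v ('X *: w) = (lam + mu + del) *: T1 u v w.
Proof.
have -> : lam + mu + del = mu + (lam + del) by ring.
by rewrite /T1 quad_sesquir (vsubstXC _ (FDr u) (FXr u)).
Qed.

Let T2X1 u v w : T2 ('X *: u) v w = - lam *: T2 u v w.
Proof. by rewrite /T2 quad_sesquil (vsubstNX _ (GDr w)). Qed.
Let T2X2 u v w : T2 u ('X *: v) w = - mu *: T2 u v w.
Proof.
have -> : - mu = lam + - (lam + mu) by ring.
by rewrite /T2 quad_sesquir (vsubstXC _ (GDr w) (GXr w)).
Qed.
Let T2X3 u v w : T2 u v ('X *: w) = (lam + mu + del) *: T2 u v w.
Proof. by apply: vsubstZf => r; apply: GXl. Qed.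

Let T3X1 u v w : T3 ('X *: u) v w = - lam *: T3 u v w.
Proof. by rewrite /T3 quad_sesquil (vsubstNX _ (HDr v)). Qed.
Let T3X2 u v w : T3 u ('X *: v) w = - mu *: T3 u v w.
Proof. by apply: vsubstZf => r; apply: HXl. Qed.
Let T3X3 u v w : T3 u v ('X *: w) = (lam + mu + del) *: T3 u v w.
Proof.
rewrite -addrA.
by rewrite /T3 quad_sesquir (vsubstXC _ (HDr v) (HXr v)).
Qed.

Let emb3 (x : V) : N3 := vconst (quad_emb x).

Let emb3D x y : emb3 (x + y) = emb3 x + emb3 y.
Proof. by rewrite /emb3 quad_embD vconstD. Qed.

Let emb3N x : emb3 (- x) = - emb3 x.
Proof. by rewrite /emb3 quad_embN vconstN. Qed.

Let F_const a x : F (vconst a) (vconst x) =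
  del *: emb3 (x ** a) + emb3 [' x, a]
  + lam *: (emb3 (a ** x) + emb3 (x ** a)).
Proof.
by rewrite /F quad_bracket_const quad_genE !vconstD -!vscaleC !vconstD.
Qed.

Let gen_subst (N : lmodType S3) (f : vpoly V -> N) q r :
    {morph f : x y / x + y} -> (forall x, f ('X *: x) = r *: f x) ->
  forall a b, vsubst f q (quad_gen a b) =
    r *: f (vconst (b ** a)) + f (vconst [' b, a])
    + q *: f (vconst (a ** b + b ** a)).
Proof.
move=> fD fX a b; apply: etrans (vsubstD q fD _ _) _; congr (_ + _).
  apply: etrans (vsubst_const q fD _) _; apply: etrans (fD _ _) _.
  by congr (_ + _); apply: fX.
apply: etrans (vsubstX q fD _) _; congr (_ *: _); exact: vsubst_const.
Qed.

Let inj_gen q a b : @vsubst _ S3 _ N3 inj q (quad_gen a b) =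
  del *: emb3 (b ** a) + emb3 [' b, a] + q *: (emb3 (a ** b) + emb3 (b ** a)).
Proof. by rewrite -emb3D; apply: gen_subst; [apply: injD | apply: injX]. Qed.

Let G_const c x : G (vconst c) (vconst x) =
  del *: emb3 (c ** x) + emb3 [' c, x]
  + (lam + mu) *: (emb3 (x ** c) + emb3 (c ** x)).
Proof. by rewrite /G quad_bracket_const inj_gen. Qed.

Let H_const b x : H (vconst b) (vconst x) =
  del *: emb3 (x ** b) + emb3 [' x, b]
  + mu *: (emb3 (b ** x) + emb3 (x ** b)).
Proof. by rewrite /H quad_bracket_const inj_gen. Qed.

Let T1_const a b c : T1 (vconst a) (vconst b) (vconst c) =
  (lam + del) *: F (vconst a) (vconst (c ** b)) + F (vconst a) (vconst [' c, b])
  + mu *: F (vconst a) (vconst (b ** c + c ** b)).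
Proof.
by rewrite /T1 quad_bracket_const; apply: gen_subst; [apply: FDr | apply: FXr].
Qed.

Let T2_const a b c : T2 (vconst a) (vconst b) (vconst c) =
  - (lam + mu) *: G (vconst c) (vconst (b ** a))
  + G (vconst c) (vconst [' b, a])
  + lam *: G (vconst c) (vconst (a ** b + b ** a)).
Proof.
by rewrite /T2 quad_bracket_const; apply: gen_subst; [apply: GDr | apply: GXr].
Qed.

Let T3_const a b c : T3 (vconst a) (vconst b) (vconst c) =
  (mu + del) *: H (vconst b) (vconst (c ** a)) + H (vconst b) (vconst [' c, a])
  + lam *: H (vconst b) (vconst (a ** c + c ** a)).
Proof.
by rewrite /T3 quad_bracket_const; apply: gen_subst; [apply: HDr | apply: HXr].
Qed.

Let J_const a b c : J (vconst a) (vconst b) (vconst c).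
Proof.
have core := quad_jacobi_gen emb3D emb3N del lam mu a b c.
rewrite /J; clearbody T1 T2 T3 F G H emb3 inj lam mu del.
by rewrite T1_const T2_const T3_const !F_const !G_const !H_const.
Qed.

Lemma quad_jacobi u v w : J u v w.
Proof.
have Jc := J_const; rewrite /J in Jc *; clearbody T1 T2 T3.
have JD (N : zmodType) (x x' y y' z z' : N) :
  x = y + z -> x' = y' + z' -> x + x' = (y + y') + (z + z').
  by move=> -> ->; rewrite addrACA.
have JZ (S : comNzRingType) (N : lmodType S) (r : S) (x y z : N) :
  x = y + z -> r *: x = r *: y + r *: z.
  by move=> ->; rewrite scalerDr.
elim/vpoly_ind: u v w => [u u' IH IH'|u IH|a] v w.
- by rewrite (T1D1 u u') (T2D1 u u') (T3D1 u u');
  apply: (JD _ _ _ _ _ _ _ (IH v w) (IH' v w)).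
- by rewrite (T1X1 u) (T2X1 u) (T3X1 u);
  apply: (JZ _ _ _ _ _ _ (IH v w)).
elim/vpoly_ind: v w => [v v' IH IH'|v IH|b] w.
- by rewrite (T1D2 _ v v') (T2D2 _ v v') (T3D2 _ v v');
  apply: (JD _ _ _ _ _ _ _ (IH w) (IH' w)).
- by rewrite (T1X2 _ v) (T2X2 _ v) (T3X2 _ v);
  apply: (JZ _ _ _ _ _ _ (IH w)).
elim/vpoly_ind: w => [w w' IH IH'|w IH|c].
- by rewrite (T1D3 _ _ w w') (T2D3 _ _ w w') (T3D3 _ _ w w');
  apply: (JD _ _ _ _ _ _ _ IH IH').
- by rewrite (T1X3 _ _ w) (T2X3 _ _ w) (T3X3 _ _ w);
  apply: (JZ _ _ _ _ _ _ IH).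
exact: Jc.
Qed.

Definition quadratic : lieConformalAlgebra K :=
  LieConformalAlgebra quad_bracketDl quad_bracketDr quad_bracketZl
    quad_bracketZr quad_sesquil quad_sesquir quad_skew quad_jacobi.

End Quadratic.

(* Main.v *)
Require Import Defs.
From mathcomp Require Import all_boot all_order all_algebra.
From mathcomp Require Import monalg.
From mathcomp Require Import classical_sets reals complex.

Set Implicit Arguments.
Unset Strict Implicit.
Unset Printing Implicit Defensive.

Import GRing.Theory.
Local Open Scope ring_scope.
Local Open Scope complex_scope.

(** If [I] is a Gel'fand-Dorfman ideal of [V], then the elements of
    [C[partial]V] all of whose coefficients lie in [I] form an ideal
    [C[partial]I] of the quadratic Lie conformal algebra, and [I] is recovered
    from [C[partial]I] as the set of its constant elements. *)

(** [submod_closed] speaks of the boolean predicate [mem I] and of combinations [a *: x + y]; this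
    form applies directly to classical sets. *)
Lemma submod_closed_setP (A : comNzRingType) (M : lmodType A) (I : set M) :
  submod_closed (mem I) <->
  [/\ I 0, forall x y, I x -> I y -> I (x + y) &
      forall (a : A) x, I x -> I (a *: x)].
Proof.
split=> [[I0 Iadd]|[I0 ID IZ]].
  have lin (a : A) x y : I x -> I y -> I (a *: x + y).
    by move=> Ix Iy; apply/set_mem/Iadd; apply/mem_set.
  have {}I0 : I 0 by apply/set_mem.
  split=> // [x y Ix Iy|a x Ix]; first by rewrite -[x]scale1r; apply: lin.
  by rewrite -[_ *: _]addr0; apply: lin.
split=> [|a x y /set_mem Ix /set_mem Iy]; apply/mem_set => //.
by apply: ID => //; apply: IZ.
Qed.

Lemma submod_closed_sum (A : comNzRingType) (M : lmodType A) (I : set M)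
    (T : Type) (r : seq T) (F : T -> M) :
  submod_closed (mem I) -> (forall i, I (F i)) -> I (\sum_(i <- r) F i).
Proof.
by move=> /submod_closed_setP[I0 ID _] IF; elim/big_ind: _.
Qed.

(** The construction iterates: for a subspace [I] of [V] it gives [K[partial]I], and applied twice
    [K[partial]I[lambda]], where the brackets must land. *)
Definition vpoly_over (A : comNzRingType) (M : lmodType A) (I : set M) :
  set (vpoly M) := [set u | forall k, I u@_k]%classic.

Lemma vpoly_over_mon (A : comNzRingType) (M : lmodType A) (I : set M) x k :
  I 0 -> I x -> vpoly_over I << x *g k >>.
Proof. by move=> I0 Ix j; rewrite mcoeffU; case: eqP. Qed.

Lemma vpoly_over_const (A : comNzRingType) (M : lmodType A) (I : set M) x :
  I 0 -> vpoly_over I (vconst x) <-> I x.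
Proof.
move=> I0; split=> [/(_ 0%N)|]; first by rewrite mcoeffUU.
exact: vpoly_over_mon.
Qed.

Lemma vpoly_over_submod (A : comNzRingType) (M : lmodType A) (I : set M) :
  submod_closed (mem I) -> submod_closed (mem (vpoly_over I)).
Proof.
move=> Isub; have [I0 ID IZ] := (submod_closed_setP I).1 Isub.
have J0 : vpoly_over I 0 by move=> k; rewrite mcoeff0.
have JD u v : vpoly_over I u -> vpoly_over I v -> vpoly_over I (u + v).
  by move=> Ju Jv k; rewrite mcoeffD; apply: ID.
apply/submod_closed_setP; split=> // p u Ju.
(* Once unfolded, [p *: u] is a double sum of monomials, each with an [A]-multiple of some [u@_k] as
   coefficient. *)
rewrite -[_ *: _]/(vscale p u) /vscale.
elim/big_ind: _ => // i _; elim/big_ind: _ => // k _.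
by apply: vpoly_over_mon => //; apply: IZ.
Qed.

Lemma vsubst_submod (A B : comNzRingType) (M : lmodType A) (N : lmodType B)
    (J : set N) (f : M -> N) (q : B) (u : vpoly M) :
  submod_closed (mem J) -> (forall k, J (f u@_k)) -> J (vsubst f q u).
Proof.
move=> Jsub Jf; apply: submod_closed_sum => // k.
by have [_ _ JZ] := (submod_closed_setP J).1 Jsub; apply: JZ.
Qed.

Section QuadraticIdeal.
Variables (K : fieldType) (V : gelfandDorfman K) (I : set V).
Hypothesis I_ideal : gd_ideal I.

(** Every term of [quad_gen a b] is a product or a Lie bracket with [b] as one factor. *)
Lemma quad_gen_over (a b : V) :
  I b -> vpoly_over (vpoly_over I) (quad_gen a b).
Proof.
move=> Ib; have [Isub Ilie Imul] := I_ideal.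
have Jsub := vpoly_over_submod Isub; have JJsub := vpoly_over_submod Jsub.
have [I0 ID IZ] := (submod_closed_setP _).1 Isub.
have [J0 JD JZ] := (submod_closed_setP _).1 Jsub.
have [_ JJD JJZ] := (submod_closed_setP _).1 JJsub.
have [Iab Iba] := Imul a b Ib.
have IN x : I x -> I (- x) by rewrite -scaleN1r; apply: IZ.
apply: JJD; last first.
  by apply: JJZ; do 2!apply/vpoly_over_const => //; apply: ID.
apply/vpoly_over_const => //; apply: JD.
  by apply: JZ; apply/vpoly_over_const.
(* [gd_ideal] absorbs [gd_lie x y] with [y] in [I], but here [b] stands first; antisymmetry swaps
   the arguments. *)
by apply/vpoly_over_const => //; rewrite gd_lieC; apply/IN/Ilie.
Qed.

Lemma quad_bracket_over (u v : vpoly V) :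
  vpoly_over I v -> vpoly_over (vpoly_over I) (quad_bracket u v).
Proof.
have [Isub _ _] := I_ideal; move=> Jv.
have JJsub := vpoly_over_submod (vpoly_over_submod Isub).
(* The outer substitution runs over the coefficients of [u], the inner one over those of [v], which
   lie in [I]. *)
apply: vsubst_submod => // k; apply: vsubst_submod => // j.
exact: quad_gen_over.
Qed.

Lemma vpoly_over_ideal : lca_ideal (vpoly_over I : set (quadratic V)).
Proof.
have [Isub _ _] := I_ideal; have Jsub := vpoly_over_submod Isub.
split=> // _ [n [k [y [yP ->]]]].
apply: submod_closed_sum => // i.
have [a [b [j [_ Jb ->]]]] := yP i.
have [_ _ JZ] := (submod_closed_setP _).1 Jsub.
by apply: JZ; apply: quad_bracket_over.
Qed.

End QuadraticIdeal.

Theorem proposition3p1 (R : realType) (V : gelfandDorfman R[i])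
    (novikov_nonzero : exists a b : V, gd_mul a b <> 0) :
  lca_simple (quadratic V) -> ~ (exists I : set V, gd_proper_ideal I).
Proof.
move=> [_ simple] [I [I_ideal I_neq0 I_neqT]].
have [/submod_closed_setP[I0 _ _] _ _] := I_ideal.
have constP x := vpoly_over_const x I0.
have [J0|JT] := simple _ (vpoly_over_ideal I_ideal).
  apply: I_neq0; apply/seteqP; split=> [x /constP|_ -> //].
  (* Now [vconst x] is zero, and its coefficient of degree 0 is [x]. *)
  rewrite J0 => /(congr1 (fun u : vpoly V => u@_0%N)).
  by rewrite mcoeffUU mcoeff0.
(* Every constant [vconst x] now has its coefficients in [I], so [I] is all of [V]. *)
by apply: I_neqT; apply/seteqP; split=> // x _; apply/constP; rewrite JT.
Qed.
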